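(* Suppose every representation $\Phi\in\mathcal{H}_\Phi$, $\Phi:\mathcal{X}\to\mathcal{Z}$ with $\mathcal{X},\mathcal{Z}\subseteq\mathbb{R}^n$, is bijective (there is $\Phi^{-1}:\mathcal{Z}\to\mathcal{X}$ with $\Phi^{-1}\circ\Phi=\mathrm{id}_{\mathcal{X}}$ and $\Phi\circ\Phi^{-1}=\mathrm{id}_{\mathcal{Z}}$), differentiable and Lipschitz continuous, and suppose the classifier class is $\mathcal{H}_w=L^p(\mathcal{Z})$. If $\bar{\mathcal{S}}^{\mathsf{IV}}_{\mathcal{Z}}$ is non-empty, then $\bar{\mathcal{S}}^{\mathsf{IV}}_{\mathcal{Z}}=\hat{\mathcal{S}}^{\mathsf{IV}}_{\mathcal{X}}(\mathsf{I})=\hat{\mathcal{S}}^{\mathsf{EIRM}}_{\mathcal{X}}(\mathsf{I})$.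
   Context: There is a finite set $\mathcal{E}_{tr}$ of environments; for each $e$ a distribution of $(X^e,Y^e)$ with $X^e\in\mathcal{X}$, real-valued label $Y^e$, and for a loss $\ell$, $R^e(f)=\mathbb{E}[\ell(f(X^e),Y^e)]$. For a set $\mathcal{A}\subseteq\mathbb{R}^n$, $L^p(\mathcal{A})$ is the set of $f:\mathcal{A}\to\mathbb{R}$ with $\int_{\mathcal{A}}|f|^p\,d\mu<\infty$ (Lebesgue measure). Given a representation class and a classifier class $\mathcal{H}$, $(\Phi,w)$ is invariant if $R^e(w\circ\Phi)\le R^e(\bar w\circ\Phi)$ for all $\bar w\in\mathcal{H}$ and all $e\in\mathcal{E}_{tr}$, and $w\circ\Phi$ is then an invariant predictor. $\hat{\mathcal{S}}^{\mathsf{IV}}_{\mathcal{Z}}$ is the set of invariant predictors $w\circ\Phi$ with $\Phi\in\mathcal{H}_\Phi$ and $\mathcal{H}=\mathcal{H}_w=L^p(\mathcal{Z})$; $\bar{\mathcal{S}}^{\mathsf{IV}}_{\mathcal{Z}}=\{u\in\hat{\mathcal{S}}^{\mathsf{IV}}_{\mathcal{Z}}: u\in L^p(\mathcal{X})\}$. $\mathsf{I}:\mathcal{X}\to\mathcal{X}$ is the identity; $\hat{\mathcal{S}}^{\mathsf{IV}}_{\mathcal{X}}(\mathsf{I})$ is the set of invariant predictors $w\circ\mathsf{I}$ using the fixed representation $\mathsf{I}$ with classifier class $L^p(\mathcal{X})$. Ensemble game with fixed representation $\mathsf{I}$: each environment $e$ chooses $w^e\in L^p(\mathcal{X})$, with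 utility $-R^e(w^{av})$ where $w^{av}=\frac{1}{|\mathcal{E}_{tr}|}\sum_q w^q$; $\hat{\mathcal{S}}^{\mathsf{EIRM}}_{\mathcal{X}}(\mathsf{I})$ is the set of ensembles $w^{av}$ arising from pure Nash equilibria $\{w^q\}$ of this game (no environment can strictly increase its utility by unilaterally changing $w^e$ within $L^p(\mathcal{X})$). *)

(* Defs.v *)
From HB Require Import structures.
From mathcomp Require Import all_boot all_order all_algebra.
From mathcomp Require Import all_classical all_reals all_analysis.
Set Implicit Arguments. Unset Strict Implicit. Unset Printing Implicit Defensive.
Import Order.TTheory GRing.Theory Num.Theory.
Import numFieldNormedType.Exports.
Local Open Scope classical_set_scope.
Local Open Scope ring_scope.

(* Points of R^n are n-tuples (which carry the Borel/product sigma-algebra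
   'measure_tuple_display'); for the metric notions (differentiability,
   Lipschitz) they are transported to row vectors 'rV[R]_n. *)
Definition Rn (R : realType) (n : nat) := n.-tuple R.

Definition rv_of (R : realType) (n : nat) (t : n.-tuple R) : 'rV[R]_n :=
  \row_i tnth t i.
Definition tup_of (R : realType) (n : nat) (v : 'rV[R]_n) : n.-tuple R :=
  [tuple v ord0 i | i < n].

Definition rv_map (R : realType) (n : nat) (f : n.-tuple R -> n.-tuple R)
  : 'rV[R]_n -> 'rV[R]_n := fun v => rv_of (f (tup_of v)).

(* Lebesgue measure on R^n, characterized as the measure on the Borel sets of
   R^n giving every closed box its volume (this determines it uniquely). *)
Definition is_lebesgue_Rn (R : realType) (n : nat)
  (leb : set (n.-tuple R) -> \bar R) : Prop :=
  forall a b : n.-tuple R, (forall i, tnth a i <= tnth b i) ->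
    leb [set x | forall i, tnth a i <= tnth x i <= tnth b i] =
    (\prod_(i < n) (tnth b i - tnth a i))%:E.

Definition Lp (R : realType) (n : nat)
  (leb : {measure set (n.-tuple R) -> \bar R}) (p : R) (A : set (n.-tuple R))
  (f : n.-tuple R -> R) : Prop :=
  measurable_fun A f /\
  (\int[leb]_(x in A) ((`|f x| `^ p)%:E) < +oo)%E.

Definition risk (R : realType) (n : nat) (E : finType)
  (P : E -> probability (n.-tuple R * R)%type R) (loss : R -> R -> R)
  (e : E) (f : n.-tuple R -> R) : \bar R :=
  (\int[P e]_xy (loss (f xy.1) xy.2)%:E)%E.

Definition invariant (R : realType) (n : nat) (E : finType)
  (P : E -> probability (n.-tuple R * R)%type R) (loss : R -> R -> R)
  (leb : {measure set (n.-tuple R) -> \bar R}) (p : R) (Z : set (n.-tuple R))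
  (Phi : n.-tuple R -> n.-tuple R) (w : n.-tuple R -> R) : Prop :=
  forall wbar : n.-tuple R -> R, Lp leb p Z wbar ->
    forall e : E, (risk P loss e (w \o Phi) <= risk P loss e (wbar \o Phi))%E.

(* \bar S^IV_Z : invariant predictors w o Phi (Phi in H_Phi, w in L^p(Z))
   which in addition lie in L^p(X).  Predictors are functions on X, so
   membership is up to agreement on X. *)
Definition SbarIV_Z (R : realType) (n : nat) (E : finType)
  (P : E -> probability (n.-tuple R * R)%type R) (loss : R -> R -> R)
  (leb : {measure set (n.-tuple R) -> \bar R}) (p : R)
  (X Z : set (n.-tuple R)) (HPhi : set (n.-tuple R -> n.-tuple R))
  : set (n.-tuple R -> R) :=
  [set u | exists Phi w, HPhi Phi /\ Lp leb p Z w /\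
       invariant P loss leb p Z Phi w /\
       (forall x, X x -> u x = w (Phi x)) /\ Lp leb p X u].

Definition ShatIV_X_id (R : realType) (n : nat) (E : finType)
  (P : E -> probability (n.-tuple R * R)%type R) (loss : R -> R -> R)
  (leb : {measure set (n.-tuple R) -> \bar R}) (p : R) (X : set (n.-tuple R))
  : set (n.-tuple R -> R) :=
  [set u | exists w, Lp leb p X w /\ invariant P loss leb p X id w /\
       (forall x, X x -> u x = w x)].

Definition wavg (R : realType) (n : nat) (E : finType)
  (ws : E -> n.-tuple R -> R) : n.-tuple R -> R :=
  fun x => (#|E|%:R)^-1 * \sum_(q : E) ws q x.

Definition deviate (R : realType) (n : nat) (E : finType)
  (ws : E -> n.-tuple R -> R) (e : E) (v : n.-tuple R -> R)
  : E -> n.-tuple R -> R :=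
  fun q => if q == e then v else ws q.

(* Pure Nash equilibrium of the ensemble game with fixed representation I;
   the utility of environment e is - R^e(w^av). *)
Definition nash_eq (R : realType) (n : nat) (E : finType)
  (P : E -> probability (n.-tuple R * R)%type R) (loss : R -> R -> R)
  (leb : {measure set (n.-tuple R) -> \bar R}) (p : R) (X : set (n.-tuple R))
  (ws : E -> n.-tuple R -> R) : Prop :=
  (forall e, Lp leb p X (ws e)) /\
  forall (e : E) (v : n.-tuple R -> R), Lp leb p X v ->
    ~ (- risk P loss e (wavg ws) < - risk P loss e (wavg (deviate ws e v)))%E.

Definition ShatEIRM_X_id (R : realType) (n : nat) (E : finType)
  (P : E -> probability (n.-tuple R * R)%type R) (loss : R -> R -> R)
  (leb : {measure set (n.-tuple R) -> \bar R}) (p : R) (X : set (n.-tuple R))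
  : set (n.-tuple R -> R) :=
  [set u | exists ws, nash_eq P loss leb p X ws /\
       (forall x, X x -> u x = wavg ws x)].

(* Main.v *)
Require Import Defs.
From HB Require Import structures.
From mathcomp Require Import all_boot all_order all_algebra.
From mathcomp Require Import all_classical all_reals all_analysis.
From mathcomp Require Import measurable_realfun lra.
Import Order.TTheory GRing.Theory Num.Theory.
Import numFieldNormedType.Exports.
Local Open Scope classical_set_scope.
Local Open Scope ring_scope.

Set Implicit Arguments.
Unset Strict Implicit.
Unset Printing Implicit Defensive.

(** Every admissible [Phi] is a Lipschitz bijection between Borel sets.  By Lusin
    separation its inverse is Borel: the images of the disjoint analytic sets
    [A] and [X `\` A] can be separated by a Borel set.  On a dyadic cube of side
    [s] the image has diameter at most [L * s], so [Phi] multiplies Lebesgue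
    measure by at most [(4 * L) ^+ n], first on dyadic cubes and then, by
    approximation, on all Borel sets.  Hence [w \o Phi^-1] is in [L^p(Z)]
    whenever [w] is in [L^p(X)].  Composition with [Phi] in the other direction
    may leave [L^p(X)]; this is where the non-emptiness hypothesis enters: an
    invariant [u0 = w0 \o Phi0] in [L^p(X)] sits between an [I]-invariant
    predictor and all competitors [wbar \o Phi0].  Finally, in the ensemble game
    any [wbar] in [L^p(X)] is reachable as an average by a unilateral deviation,
    so Nash ensembles are exactly the [I]-invariant predictors. *)

(** * Dyadic cells *)

(** Coordinate projections generate the sigma-algebra of tuples, and rays []c, +oo[] generate that
    of the line. Stated for a predicate [Q], this is an induction principle over Borel sets. *)
Lemma halfspaces_generate (R : realType) (n : nat) (Q : set (set (n.-tuple R))) :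
  sigma_algebra setT Q ->
  (forall i c, Q [set x | tnth x i <= c]) ->
  forall A, measurable A -> Q A.
Proof.
move=> sQ hQ A; apply: smallest_sub => //.
suff coord : forall i : 'I_n, preimage_set_system setT
    (fun x : n.-tuple R => tnth x i) measurable `<=` Q.
  elim/big_rec: _ => [? []|i y _ yQ B [/coord|/yQ]//].
move=> i B [D mD <-]; rewrite setTI.
have [Q0 QC QU] := sQ.
have : (@RGenOInfty.G R).-sigma.-measurable D by rewrite -RGenOInfty.measurableE.
move: D {mD}; apply: smallest_sub.
  split => [|D QD|F QF]; rewrite /mkset.
  - by rewrite preimage_set0.
  - by rewrite setTD -preimage_setC -setTD; exact: QC.
  - by rewrite preimage_bigcup; exact: QU.
move=> D [c ->]; rewrite /mkset.
rewrite (_ : _ @^-1` _ = setT `\` [set x | tnth x i <= c]); first exact: QC.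
apply/seteqP; split=> x /=; rewrite in_itv/= andbT ltNge; first by move=> /negP.
by move=> [_ /negP].
Qed.

(** The index of the half-open dyadic cube of side [(2 ^+ m)^-1] around [x]. *)
Definition cell (R : realType) (n m : nat) (x : n.-tuple R) : n.-tuple int :=
  [tuple Num.floor (2 ^+ m * tnth x i) | i < n].

Lemma tnth_cell (R : realType) (n m : nat) (x : n.-tuple R) i :
  tnth (cell m x) i = Num.floor (2 ^+ m * tnth x i).
Proof. by rewrite tnth_mktuple. Qed.

Lemma cell_ge (R : realType) (n m : nat) (x : n.-tuple R) i :
  (tnth (cell m x) i)%:~R / 2 ^+ m <= tnth x i.
Proof. by rewrite tnth_cell ler_pdivrMr ?exprn_gt0// mulrC floor_le. Qed.

Lemma cell_lt (R : realType) (n m : nat) (x : n.-tuple R) i :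
  tnth x i < ((tnth (cell m x) i)%:~R + 1) / 2 ^+ m.
Proof.
by rewrite tnth_cell ltr_pdivlMr ?exprn_gt0// mulrC -intrD1 floorD1_gt.
Qed.

Lemma cell_step (R : realType) (n m : nat) (x y : n.-tuple R) :
  cell m.+1 x = cell m.+1 y -> cell m x = cell m y.
Proof.
move=> xy; apply: eq_from_tnth => i; rewrite !tnth_cell.
have := congr1 (fun t => tnth t i) xy; rewrite !tnth_cell => {}xy.
(* The level [m] floor is determined by which even integers lie below the level [m.+1] floor. *)
have E (a : R) (z : int) :
    (z <= Num.floor (2 ^+ m * a)) = (2 * z <= Num.floor (2 ^+ m.+1 * a)).
  by rewrite !floor_ge_int intrM exprS -mulrA ler_pM2l.
apply/eqP; rewrite eq_le; apply/andP; split.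
  by rewrite E -xy -E.
by rewrite E xy -E.
Qed.

Lemma cell_mono (R : realType) (n m k : nat) (x y : n.-tuple R) :
  (m <= k)%N -> cell k x = cell k y -> cell m x = cell m y.
Proof.
by move=> /subnKC <-; elim: (k - m)%N => [|d IH]; rewrite ?addn0// addnS => /cell_step.
Qed.

Lemma measurable_tnth_le (R : realType) (n : nat) (i : 'I_n) (c : R) :
  measurable [set x : n.-tuple R | tnth x i <= c].
Proof.
rewrite (_ : mkset _ = setT `&` (fun x : n.-tuple R => tnth x i) @^-1` `]-oo, c]).
  by apply: measurable_tnth => //; exact: measurable_itv.
by rewrite setTI; apply/seteqP; split => x /=; rewrite in_itv.
Qed.

Lemma measurable_tnth_lt (R : realType) (n : nat) (i : 'I_n) (c : R) :
  measurable [set x : n.-tuple R | tnth x i < c].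
Proof.
rewrite (_ : mkset _ = setT `&` (fun x : n.-tuple R => tnth x i) @^-1` `]-oo, c[).
  by apply: measurable_tnth => //; exact: measurable_itv.
by rewrite setTI; apply/seteqP; split => x /=; rewrite in_itv.
Qed.

Lemma measurable_box (R : realType) (n : nat) (a b : n.-tuple R) :
  measurable [set x : n.-tuple R | forall i, tnth a i <= tnth x i <= tnth b i].
Proof.
rewrite (_ : mkset _ = \bigcap_(i in [set: 'I_n])
  ((~` [set x | tnth x i < tnth a i]) `&` [set x | tnth x i <= tnth b i])).
  apply: fin_bigcap_measurable => // i _.
  by apply: measurableI; [apply: measurableC; apply: measurable_tnth_lt|apply: measurable_tnth_le].
apply/seteqP; split => x /= H i => [_|].
  by have /andP[H1 H2] := H i; split => //=; apply/negP; rewrite -leNgt.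
by have /= [/negP + ->] := H i I; rewrite -leNgt andbT.
Qed.

Lemma measurable_cell_eq (R : realType) (n m : nat) (c : n.-tuple int) :
  measurable (cell m @^-1` [set c] : set (n.-tuple R)).
Proof.
rewrite (_ : _ @^-1` _ = \bigcap_(i in [set: 'I_n])
  ((~` [set x : n.-tuple R | tnth x i < (tnth c i)%:~R / 2 ^+ m]) `&`
   [set x | tnth x i < ((tnth c i)%:~R + 1) / 2 ^+ m])).
  apply: fin_bigcap_measurable => // i _.
  by apply: measurableI; [apply: measurableC|]; apply: measurable_tnth_lt.
apply/seteqP; split => x /=.
  by move=> <- i _ /=; split; [apply/negP; rewrite -leNgt cell_ge|exact: cell_lt].
move=> H; apply: eq_from_tnth => i; have /= [/negP + +] := H i I.
rewrite -leNgt ler_pdivrMr ?exprn_gt0// ltr_pdivlMr ?exprn_gt0// => H1 H2.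
by rewrite tnth_cell; apply: floor_def; rewrite intrD1 mulrC H1.
Qed.

Lemma measurable_cell (R : realType) (n m : nat) (S : set (n.-tuple int)) :
  measurable (cell m @^-1` S : set (n.-tuple R)).
Proof.
rewrite (_ : _ @^-1` _ = \bigcup_(c in S) (cell m @^-1` [set c])).
  rewrite bigcup_mkcond; apply: countable_bigcupT_measurable => // c.
  by case: ifP => _; [apply: measurable_cell_eq|exact: measurable0].
by apply/seteqP; split => [x Sx|x [c Sc /= ->]//]; exists (cell m x).
Qed.

Lemma half_pow_lt (R : realType) (e : R) : 0 < e -> exists m, (2 ^+ m)^-1 < e.
Proof.
move=> e0; exists (Num.truncn e^-1).+1.
rewrite invf_plt ?posrE ?exprn_gt0//.
apply: (@lt_trans _ _ (Num.truncn e^-1).+1%:R); first by rewrite truncnS_gt.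
by rewrite -natrX ltr_nat ltn_expl.
Qed.

(** A point violates [tnth x i <= c] exactly when, at some level, the lower face of its cell exceeds
    [c]. A half-space is thus the complement of a countable union of sets of cells. *)
Lemma cells_generate (R : realType) (n : nat) (Q : set (set (n.-tuple R))) :
  sigma_algebra setT Q ->
  (forall m S, Q (cell m @^-1` S)) ->
  forall A, measurable A -> Q A.
Proof.
move=> sQ hQ; apply: halfspaces_generate => // i c.
have [Q0 QC QU] := sQ.
rewrite (_ : mkset _ = setT `\` \bigcup_m
  (@cell R n m @^-1` [set q | c * 2 ^+ m < (tnth q i)%:~R])).
  by apply: QC; apply: QU.
apply/seteqP; split => x /=.
  move=> xc; split => // -[m _ /=]; apply/negP; rewrite -leNgt.
  by rewrite -ler_pdivrMr ?exprn_gt0// (le_trans (cell_ge _ _ _)).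
move=> [_ H]; rewrite leNgt; apply/negP => cx; apply: H.
have [m hm] : exists m, (2 ^+ m)^-1 < tnth x i - c by apply: half_pow_lt; rewrite subr_gt0.
exists m => //=; have := cell_lt m x i.
have p0 : 0 < 2 ^+ m :> R by rewrite exprn_gt0.
rewrite -ltr_pdivlMr//; move: hm; rewrite mulrDl mul1r; lra.
Qed.

(** * Analytic sets and Lusin separation *)

Definition close (R : realType) (n : nat) (e : R) (x y : n.-tuple R) :=
  forall i, `|tnth x i - tnth y i| < e.

(* [C] is closed in the product of the Baire space with R^n; analytic sets are
   the projections of such relations to R^n. *)
Definition closed_rel (R : realType) (n : nat)
    (C : (nat -> nat) -> set (n.-tuple R)) :=
  forall a x,
    (forall k e, 0 < e -> exists b y,
       [/\ forall j, (j < k)%N -> b j = a j, close e x y & C b y]) -> C a x.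

Definition analytic (R : realType) (n : nat) (A : set (n.-tuple R)) :=
  exists2 C, closed_rel C & forall x, A x <-> exists a, C a x.

Lemma analytic_closed (R : realType) (n : nat) (A : set (n.-tuple R)) :
  (forall x, (forall e, 0 < e -> exists2 y, close e x y & A y) -> A x) ->
  analytic A.
Proof.
move=> clA; exists (fun=> A) => [a x H|x]; last first.
  by split => [Ax|[]//]; exists (fun=> 0%N).
by apply: clA => e /(H 0%N) [b [y [_ xy Ay]]]; exists y.
Qed.

(** The first digit of a code chooses [i], and the remaining digits witness membership in [F i]. *)
Lemma analytic_bigcup (R : realType) (n : nat) (F : nat -> set (n.-tuple R)) :
  (forall i, analytic (F i)) -> analytic (\bigcup_i F i).
Proof.
move=> /(_ _)/cid2-/all_sig2[C clC FC].
exists (fun a => C (a 0%N) (a \o succn)) => [a x H|x].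
  apply: clC => k e e0; have [b [y [ba xy Cy]]] := H k.+1 e e0.
  exists (b \o succn), y; split => //=; first by move=> j jk; exact: ba.
  by rewrite -ba.
split => [[i _ /FC[a Ca]]|[a Ca]]; last by exists (a 0%N) => //; apply/FC; eexists; exact: Ca.
by exists (fun j => if j is j'.+1 then a j' else i).
Qed.

(** A single code carries one code per set: its digit at [pickle (i, j)] is digit [j] of the code
    for [F i]. *)
Lemma analytic_bigcap (R : realType) (n : nat) (F : nat -> set (n.-tuple R)) :
  (forall i, analytic (F i)) -> analytic (\bigcap_i F i).
Proof.
move=> /(_ _)/cid2-/all_sig2[C clC FC].
pose sub (a : nat -> nat) (i j : nat) := a (pickle (i, j)).
exists (fun a => [set x | forall i, C i (sub a i) x]) => [a x H i|x].
  apply: clC => k e e0.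
  (* A prefix of length [K] contains the first [k] digits of the [i]-th subcode. *)
  pose K := (\max_(j < k) (pickle (i, (j : nat))).+1)%N.
  have [b [y [ba xy Cy]]] := H K e e0.
  exists (sub b i), y; split => // j jk; apply: ba.
  exact: (@leq_bigmax _ (fun j : 'I_k => (pickle (i, (j : nat))).+1) (Ordinal jk)).
split => [Fx|[a Ca] i _]; last by apply/FC; exists (sub a i); exact: Ca.
have /choice[a Ca] : forall i, exists a, C i a x by move=> i; apply/FC; exact: Fx.
exists (fun m => if unpickle m is Some (i, j) then a i j else 0%N) => i /=.
by rewrite /sub; under eq_fun do rewrite pickleK.
Qed.

(** The sets that are analytic together with their complements form a sigma-algebra. A half-space is
    closed, and its complement is a countable union of closed sets. *)
Lemma measurable_analytic (R : realType) (n : nat) (A : set (n.-tuple R)) :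
  measurable A -> analytic A.
Proof.
suff H : measurable A -> analytic A /\ analytic (~` A) by move=> /H[].
move: A; apply: (@halfspaces_generate _ _ (fun A => analytic A /\ analytic (~` A))).
  split => [|A [A1 A2]|F aF].
  - split; apply: analytic_closed => //= x.
      by move=> /(_ 1 ltr01)[].
    by move=> _ [].
  - by rewrite setTD setCK.
  - split; first by apply: analytic_bigcup => i; have [] := aF i.
    by rewrite setC_bigcup; apply: analytic_bigcap => i; have [] := aF i.
move=> i c; split.
  apply: analytic_closed => x H /=; rewrite leNgt; apply/negP => cx.
  have [y /(_ i)] := H (tnth x i - c) ltac:(lra).
  by rewrite ltr_norml /= => /andP[]; lra.
rewrite (_ : ~` _ = \bigcup_k [set x | c + (2 ^+ k)^-1 <= tnth x i]).
  apply: analytic_bigcup => k; apply: analytic_closed => x H /=.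
  rewrite leNgt; apply/negP => cx.
  have [y /(_ i)] := H (c + (2 ^+ k)^-1 - tnth x i) ltac:(lra).
  by rewrite ltr_norml /= => /andP[]; lra.
apply/seteqP; split => x /=.
  move=> /negP; rewrite -ltNge => cx.
  have [k hk] : exists k, (2 ^+ k)^-1 < tnth x i - c by apply: half_pow_lt; lra.
  by exists k => //=; lra.
move=> [k _ /= H]; apply/negP; rewrite -ltNge.
by rewrite (lt_le_trans _ H)// ltrDl invr_gt0 exprn_gt0.
Qed.

Definition borel_sep (R : realType) (n : nat) (P Q : set (n.-tuple R)) :=
  exists M : set (n.-tuple R), [/\ measurable M, P `<=` M & forall x, Q x -> ~ M x].

(** If [M (i, j)] separates [F i] from [G j], the union over [i] of the intersections over [j]
    separates [P] from [Q]. *)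
Lemma borel_sep_bigcup (R : realType) (n : nat) (I J : countType)
    (P Q : set (n.-tuple R)) (F : I -> set (n.-tuple R)) (G : J -> set (n.-tuple R)) :
  (forall x, P x -> exists i, F i x) -> (forall x, Q x -> exists j, G j x) ->
  (forall i j, borel_sep (F i) (G j)) -> borel_sep P Q.
Proof.
move=> PF QG sep.
have /choice[M hM] : forall ij : I * J, exists M : set (n.-tuple R),
    [/\ measurable M, F ij.1 `<=` M & forall x, G ij.2 x -> ~ M x].
  by move=> [i j]; exact: sep.
exists (\bigcup_i ~` \bigcup_j ~` M (i, j)); split.
- apply: countable_bigcupT_measurable => // i; apply: measurableC.
  apply: countable_bigcupT_measurable => // j; apply: measurableC.
  by have [] := hM (i, j).
- move=> x /PF[i Fx]; exists i => // -[j _]; apply.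
  by have [_ + _] := hM (i, j); exact.
- move=> x /QG[j Gx] [i _]; apply; exists j => // Mx.
  by have [_ _ /(_ x Gx)] := hM (i, j).
Qed.

(* The pieces of [A] with code digits and dyadic cells prescribed along [D]
   shrink to a single point, which lies in [A] because [C] is closed. *)
Lemma piece_limit (R : realType) (n : nat) (C : (nat -> nat) -> set (n.-tuple R))
    (D : nat -> nat * n.-tuple int) :
  closed_rel C ->
  (forall k, exists b y, C b y /\ forall j, (j < k)%N -> D j = (b j, cell j y)) ->
  exists2 x, (exists a, C a x) & forall e, 0 < e -> exists k, forall y,
    cell k y = (D k).2 -> close e x y.
Proof.
move=> clC hD.
pose q j i : R := (tnth (D j).2 i)%:~R.
(* Every lower face lies below every upper face, because a single point follows [D] through both
   levels. *)
have lu j k i : q j i / 2 ^+ j <= (q k i + 1) / 2 ^+ k.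
  have [b [y [_ Dy]]] := hD (maxn j k).+1.
  have [Dj Dk] : (D j).2 = cell j y /\ (D k).2 = cell k y.
    by rewrite !Dy// ltnS ?leq_maxl ?leq_maxr.
  by rewrite /q Dj Dk (le_trans (cell_ge _ _ _))// ltW// cell_lt.
pose x := [tuple sup (range (fun j => q j i / 2 ^+ j)) | i < n].
have xge j i : q j i / 2 ^+ j <= tnth x i.
  rewrite tnth_mktuple; apply: ub_le_sup; last by exists j.
  by exists ((q 0%N i + 1) / 2 ^+ 0) => _ [k _ <-]; exact: lu.
have xle j i : tnth x i <= (q j i + 1) / 2 ^+ j.
  rewrite tnth_mktuple; apply: ge_sup; first by exists (q 0%N i / 2 ^+ 0), 0%N.
  by move=> _ [k _ <-]; exact: lu.
have shrink e : 0 < e -> exists k, forall j y, (k <= j)%N ->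
    cell j y = (D j).2 -> close e x y.
  move=> /half_pow_lt[k ke]; exists k => j y kj yD i.
  have ylt := cell_lt j y i; have yge := cell_ge j y i.
  rewrite yD -/(q j i) in ylt yge.
  have je : (2 ^+ j)^-1 < e.
    apply: le_lt_trans ke; rewrite lef_pV2 ?posrE ?exprn_gt0//.
    by rewrite ler_weXn2l// ler1n.
  move: (xge j i) (xle j i) ylt yge; rewrite !(mulrDl (q j i)) mul1r ltr_norml.
  by move: je => *; apply/andP; split; lra.
exists x; last by move=> e /shrink[k hk]; exists k => y; exact: hk.
exists (fun j => (D j).1); apply: clC => k e /shrink[m hm].
have [b [y [Cy Dy]]] := hD (maxn k m).+1.
exists b, y; split => //.
  by move=> j jk; rewrite Dy// (leq_trans jk)// ltnW// ltnS leq_maxl.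
by apply: (hm (maxn k m)); rewrite ?leq_maxr// Dy.
Qed.

(** By contradiction: if the images of two pieces cannot be separated, [borel_sep_bigcup] yields
    subpieces, one digit longer, with the same defect. Iteration produces pieces shrinking to some
    [x] in [A] and [y] in [B]. Since [f x <> f y], continuity puts the images of small pieces into
    disjoint slabs, which are separated. *)
Lemma lusin_separation (R : realType) (n : nat) (f : n.-tuple R -> n.-tuple R)
    (X A B : set (n.-tuple R)) :
  (forall x, X x -> forall e, 0 < e -> exists2 d, 0 < d &
     forall y, X y -> close d x y -> close e (f x) (f y)) ->
  (forall x y, X x -> X y -> f x = f y -> x = y) ->
  A `<=` X -> B `<=` X -> A `&` B = set0 ->
  analytic A -> analytic B -> borel_sep (f @` A) (f @` B).
Proof.
move=> fc finj AX BX AB0 [C clC AC] [C' clC' BC'].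
pose digit := (nat * n.-tuple int)%type.
pose piece (K : (nat -> nat) -> set (n.-tuple R)) (s : seq digit) : set (n.-tuple R) :=
  [set x | exists2 b, K b x & s = mkseq (fun j => (b j, cell j x)) (size s)].
have pieceS K s x : piece K s x -> exists d, piece K (rcons s d) x.
  move=> [b Kb sE]; exists (b (size s), cell (size s) x); exists b => //.
  by rewrite size_rcons mkseqS -sE.
pose bad (st : seq digit * seq digit) :=
  ~ borel_sep (f @` piece C st.1) (f @` piece C' st.2).
apply: contrapT => nsep.
have bad0 : bad ([::], [::]).
  apply: contra_not nsep => /= -[M [mM PM QM]]; exists M; split => //.
    by move=> _ [x /AC[a Ca] <-]; apply: PM; exists x => //; exists a.
  by move=> _ [x /BC'[a Ca] <-]; apply: QM; exists x => //; exists a.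
have /choice[g hg] : forall st, exists dd : digit * digit,
    bad st -> bad (rcons st.1 dd.1, rcons st.2 dd.2).
  move=> [s t]; apply: contrapT => /forallNP H.
  (* If the pair is not bad, any extension satisfies the implication, so default digits do. *)
  have /= bst : bad (s, t) by apply: contrapT => nb; exact: (H ((0%N, [tuple 0 | i < n]), (0%N, [tuple 0 | i < n]))).
  apply: bst => /=.
  apply: (@borel_sep_bigcup _ _ digit digit _ _ (fun d => f @` piece C (rcons s d))
            (fun d => f @` piece C' (rcons t d))).
  - by move=> _ [x /pieceS[d px] <-]; exists d, x.
  - by move=> _ [x /pieceS[d px] <-]; exists d, x.
  - move=> i j; apply: contrapT => nij; exact: (H (i, j)).
pose st := fix st k := if k is k'.+1 then
   (rcons (st k').1 (g (st k')).1, rcons (st k').2 (g (st k')).2) else ([::], [::]).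
have badst : forall k, bad (st k) by elim=> // k IH /=; exact: hg.
have st1 : forall k, (st k).1 = mkseq (fun j => (g (st j)).1) k.
  by elim=> [//|m IH] /=; rewrite IH mkseqS.
have st2 : forall k, (st k).2 = mkseq (fun j => (g (st j)).2) k.
  by elim=> [//|m IH] /=; rewrite IH mkseqS.
have pieceD K (D : nat -> digit) k x : piece K (mkseq D k) x ->
    exists2 b, K b x & forall j, (j < k)%N -> D j = (b j, cell j x).
  rewrite /piece /= size_mkseq => -[b Kb E]; exists b => // j jk.
  by have := congr1 (fun s => nth (D 0%N) s j) E; rewrite !nth_mkseq.
(* Bad pairs consist of non-empty pieces, since [set0] or [setT] would separate an empty piece from
   anything; hence [piece_limit] applies to both branches. *)
have [x [a Ca] xlim] : exists2 x, (exists a, C a x) & forall e, 0 < e -> exists k, forall y,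
    cell k y = (g (st k)).1.2 -> close e x y.
  apply: (@piece_limit _ _ C (fun k => (g (st k)).1) clC) => k; apply: contrapT => H; apply: (badst k).
  exists set0; split; [exact: measurable0| |by move=> ? _ []].
  move=> _ [y py <-] /=; apply: H; move: py; rewrite st1 => /pieceD[b Cb hb].
  by exists b, y.
have [y [b Cb] ylim] : exists2 x, (exists a, C' a x) & forall e, 0 < e -> exists k, forall y,
    cell k y = (g (st k)).2.2 -> close e x y.
  apply: (@piece_limit _ _ C' (fun k => (g (st k)).2) clC') => k; apply: contrapT => H; apply: (badst k).
  exists setT; split; [exact: measurableT|by []|move=> _ [y py <-] _; apply: H].
  by move: py; rewrite st2 => /pieceD[b Cb hb]; exists b, y.
have Ax : A x by apply/AC; exists a.
have By : B y by apply/BC'; exists b.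
have fxy : f x <> f y.
  move=> /finj => /(_ (AX _ Ax) (BX _ By)) xy.
  have : (A `&` B) x by split => //; rewrite xy.
  by rewrite AB0.
have [i fi] : exists i, tnth (f x) i != tnth (f y) i.
  apply: contrapT => /forallNP H; apply: fxy; apply: eq_from_tnth => i.
  by apply/eqP/negPn/negP; exact: H.
(* Half the gap in coordinate [i], so that the slabs of radius [e] about [f x] and [f y] are
   disjoint. *)
pose e := `|tnth (f x) i - tnth (f y) i| / 2.
have e0 : 0 < e by rewrite divr_gt0// normr_gt0 subr_eq0.
have [d d0 fd] := fc x (AX _ Ax) e e0.
have [d' d'0 fd'] := fc y (BX _ By) e e0.
have [k hk] := xlim d d0; have [k' hk'] := ylim d' d'0.
(* A prefix of length [k.+1] is what fixes the cell of level [k]. *)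
apply: (badst (maxn k k').+1).
exists [set z | `|tnth (f x) i - tnth z i| < e]; split.
- rewrite (_ : mkset _ = (~` [set z | tnth z i <= tnth (f x) i - e]) `&`
      [set z | tnth z i < tnth (f x) i + e]).
    by apply: measurableI; [apply: measurableC; apply: measurable_tnth_le|apply: measurable_tnth_lt].
  apply/seteqP; split => z /=; rewrite ltr_norml.
    by move=> /andP[? ?]; split; [apply/negP; rewrite -ltNge|]; lra.
  by move=> [/negP]; rewrite -ltNge => ? ?; apply/andP; split; lra.
- move=> _ [z + <-]; rewrite st1 => /pieceD[c Cc hc] /=; apply: fd.
    by apply: AX; apply/AC; exists c.
  by apply: hk; rewrite hc// ltnS leq_maxl.
- move=> _ [z + <-]; rewrite st2 => /pieceD[c Cc hc] /= fxz.
  have fyz : `|tnth (f y) i - tnth (f z) i| < e.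
    apply: fd'; first by apply: BX; apply/BC'; exists c.
    by apply: hk'; rewrite hc// ltnS leq_maxr.
  have := ler_distD (tnth (f z) i) (tnth (f x) i) (tnth (f y) i).
  by rewrite (distrC (tnth (f z) i)); move: fxz fyz; rewrite /e; lra.
Qed.

(** The images of [A] and of its complement in [X] cover [Z], so a Borel set separating them meets
    [Z] in exactly the image of [A]. *)
Lemma measurable_image_inj (R : realType) (n : nat) (f : n.-tuple R -> n.-tuple R)
    (X Z A : set (n.-tuple R)) :
  (forall x, X x -> forall e, 0 < e -> exists2 d, 0 < d &
     forall y, X y -> close d x y -> close e (f x) (f y)) ->
  (forall x y, X x -> X y -> f x = f y -> x = y) ->
  f @` X = Z -> measurable X -> measurable Z -> measurable A ->
  A `<=` X -> measurable (f @` A).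
Proof.
move=> fc finj fXZ mX mZ mA AX.
have [M [mM AM XAM]] : borel_sep (f @` A) (f @` (X `\` A)).
  apply: (lusin_separation fc finj) => //.
  - by rewrite setDE setICA setICr setI0.
  - exact: measurable_analytic.
  - by apply: measurable_analytic; exact: measurableD.
rewrite (_ : f @` A = Z `&` M); first exact: measurableI.
apply/seteqP; split => [y fAy|y [+ My]].
  by split; [rewrite -fXZ; case: fAy => x /AX Xx <-; exists x|exact: AM].
rewrite -fXZ => -[x Xx fxy]; have [Ax|nAx] := pselect (A x); first by exists x.
by exfalso; apply: (XAM y) => //; exists x.
Qed.

(** * Comparison of measures on dyadic cells *)

Lemma le_measure_fibres d (T : measurableType d) (R : realType) (I : countType)
    (h : T -> I) (nu mu : {measure set T -> \bar R}) (A : set T) :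
  (forall c, measurable (h @^-1` [set c])) -> measurable A ->
  (forall c, (nu (A `&` h @^-1` [set c]) <= mu (A `&` h @^-1` [set c]))%E) ->
  (nu A <= mu A)%E.
Proof.
move=> mh mA le_fibre.
(* Fibres are listed by their [pickle] codes to form a sequence; unattained codes give the empty
   set. *)
pose F k := A `&` [set x | pickle (h x) = k].
have FE k : (exists c, F k = A `&` h @^-1` [set c]) \/ F k = set0.
  have [[c ck]|nck] := pselect (exists c : I, pickle c = k).
    left; exists c; congr (_ `&` _); apply/seteqP; split => x /=; last by move=> ->.
    by rewrite -ck => /(pcan_inj pickleK).
  by right; apply/seteqP; split => x // [_ /= hx]; apply: nck; exists (h x).
have mF k : measurable (F k).
  by have [[c ->]|->] := FE k; [exact: measurableI|exact: measurable0].
have tF : trivIset setT F.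
  by move=> i j _ _ [x [[_ /= xi] [_ /= xj]]]; rewrite -xi.
have UF : \bigcup_k F k = A.
  by apply/seteqP; split => [x [k _ []]//|x Ax]; exists (pickle (h x)).
rewrite -UF !measure_semi_bigcup//; try exact: bigcupT_measurable.
apply: lee_nneseries => // k _.
by have [[c ->]|->] := FE k; rewrite ?measure0.
Qed.

(** The approximable sets form a sigma-algebra: complements keep the symmetric difference, finite
    unions use a common finer level, and countable unions use continuity from above, which relies on
    [lam D] being finite. *)
Lemma cell_approximation (R : realType) (n : nat)
    (lam : {measure set (n.-tuple R) -> \bar R}) (D : set (n.-tuple R)) :
  measurable D -> (lam D < +oo)%E ->
  forall A, measurable A -> forall e : R, 0 < e -> exists m S,
    let B := cell m @^-1` S in
    (lam (((A `\` B) `|` (B `\` A)) `&` D) <= e%:E)%E.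
Proof.
move=> mD finD.
pose sd (A B : set (n.-tuple R)) := ((A `\` B) `|` (B `\` A)) `&` D.
have msd A B : measurable A -> measurable B -> measurable (sd A B).
  by move=> mA mB; apply: measurableI => //; apply: measurableU; exact: measurableD.
pose approx (A : set (n.-tuple R)) := forall e : R, 0 < e -> exists m S,
  (lam (sd A (cell m @^-1` S)) <= e%:E)%E.
suff H : forall A, measurable A -> measurable A /\ approx A by move=> A /H[].
have approx0 : approx set0.
  move=> e e0; exists 0%N, set0.
  by rewrite /sd preimage_set0 !set0D setU0 set0I measure0 lee_fin ltW.
have approxU A B : measurable A -> measurable B -> approx A -> approx B -> approx (A `|` B).
  move=> mA mB aA aB e e0; have e20 : 0 < e / 2 by rewrite divr_gt0.
  have [m [S hS]] := aA (e / 2) e20.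
  have [k [S' hS']] := aB (e / 2) e20.
  have coarsen l (U : set (n.-tuple int)) : (l <= maxn m k)%N ->
      @cell R n l @^-1` U =
      @cell R n (maxn m k) @^-1` (cell (maxn m k) @` (@cell R n l @^-1` U)).
    move=> lmk; apply/seteqP; split => [x Ux|x [y Uy yx]]; first by exists x.
    by rewrite /preimage /= -(cell_mono lmk yx).
  exists (maxn m k),
    (cell (maxn m k) @` ((@cell R n m @^-1` S) `|` (@cell R n k @^-1` S'))).
  rewrite image_setU preimage_setU -(coarsen m) ?leq_maxl// -(coarsen k) ?leq_maxr//.
  apply: (@le_trans _ _ (lam (sd A (cell m @^-1` S) `|` sd B (cell k @^-1` S')))).
    apply: le_measure; rewrite ?inE.
    - by apply: msd; apply: measurableU => //; exact: measurable_cell.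
    - by apply: measurableU; apply: msd => //; exact: measurable_cell.
    - move=> x [[[[?|?] /not_orP[? ?]]|[[?|?] /not_orP[? ?]]] ?].
      + by left; split => //; left.
      + by right; split => //; left.
      + by left; split => //; right.
      + by right; split => //; right.
  rewrite (splitr e) EFinD (le_trans (measureU2 _ _ _)) ?leeD//;
    by apply: msd => //; exact: measurable_cell.
apply: (@cells_generate _ _ (fun A => measurable A /\ approx A)); last first.
  move=> m S; split; first exact: measurable_cell.
  move=> e e0; exists m, S.
  by rewrite /sd !setDv setU0 set0I measure0 lee_fin ltW.
split => [|A [mA aA]|F GF].
- by split; [apply: measurable0|].
- split; first by rewrite setTD; exact: measurableC.
  move=> e /aA[m [S hS]]; exists m, (~` S); apply: le_trans hS.
  rewrite le_eqVlt; apply/orP; left; apply/eqP; congr (lam (_ `&` D)).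
  rewrite setTD preimage_setC; apply/seteqP; split => x /=.
    by move=> [[? /contrapT]|[? /contrapT]]; [right|left].
  by move=> [[? ?]|[? ?]]; [right|left]; split => //; apply.
have mF i : measurable (F i) by have [] := GF i.
have aF i : approx (F i) by have [] := GF i.
split; first exact: bigcupT_measurable.
move=> e e0; have e20 : 0 < e / 2 by rewrite divr_gt0.
pose U N := \big[setU/set0]_(i < N) F i.
have mU N : measurable (U N) by apply: bigsetU_measurable.
have aU N : approx (U N).
  rewrite /U; elim: N => [|N IH]; first by rewrite big_ord0.
  by rewrite big_ord_recr; apply: approxU => //; exact: mU.
(* The tail left by the first [N] sets; its measure tends to zero. *)
pose W N := (\bigcup_i F i `\` U N) `&` D.
have mW N : measurable (W N).
  by apply: measurableI => //; apply: measurableD => //; exact: bigcupT_measurable.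
have W0 : \bigcap_N W N = set0.
  apply/seteqP; split => x // H; have [[[i _ Fx] _] _] := H 0%N I.
  have [[_ nU] _] := H i.+1 I; apply: nU.
  by rewrite /U big_ord_recr; right.
have [N hN] : exists N, (lam (W N) < (e / 2)%:E)%E.
  have cW : (lam \o W) x @[x --> \oo] --> lam (\bigcap_N W N).
    apply: nonincreasing_cvg_mu => //.
    - apply: le_lt_trans finD; apply: le_measure; rewrite ?inE//.
      exact: subIsetr.
    - by rewrite W0; exact: measurable0.
    - move=> k l kl; apply/subsetPset => x [[Fx nU] Dx]; split => //; split => // Ux.
      by apply: nU; exact: (subset_bigsetU kl).
  rewrite W0 measure0 in cW.
  have : nbhs (0 : \bar R)%E [set y | (y < (e / 2)%:E)%E].
    by apply: open_nbhs_nbhs; split; [exact: open_ereal_lt_ereal|rewrite /= lte_fin].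
  by move=> /cW[N _ hN]; exists N; exact: (hN N (leqnn N)).
have [m [S hS]] := aU N (e / 2) e20.
exists m, S.
have mS := @measurable_cell R n m S.
apply: (@le_trans _ _ (lam (W N `|` sd (U N) (cell m @^-1` S)))).
  apply: le_measure; rewrite ?inE.
  - by apply: msd => //; exact: bigcupT_measurable.
  - by apply: measurableU => //; exact: msd.
  - move=> x [[[Fx nS]|[Sx nF]] Dx].
    + have [Ux|nU] := pselect (U N x); last by left.
      by right; split => //; left.
    + right; split => //; right; split => // Ux; apply: nF.
      exact: (bigsetU_bigcup Ux).
rewrite (splitr e) EFinD (le_trans (measureU2 _ _ _)) ?leeD//; first exact: msd.
exact: ltW.
Qed.

(** Within a unit cell [D], a Borel set is replaced by a union of small cells, on which the
    comparison is a countable sum; the error is then sent to zero. *)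
Lemma le_measure_cells (R : realType) (n : nat)
    (nu mu : {measure set (n.-tuple R) -> \bar R}) :
  (forall c, (mu (cell 0 @^-1` [set c]) < +oo)%E) ->
  (forall m c, (nu (cell m @^-1` [set c]) <= mu (cell m @^-1` [set c]))%E) ->
  forall A, measurable A -> (nu A <= mu A)%E.
Proof.
move=> fin0 le_cell A mA.
apply: (@le_measure_fibres _ _ _ _ (@cell R n 0)) => // c; first exact: measurable_cell_eq.
set D := _ @^-1` _.
have mD : measurable D by exact: measurable_cell_eq.
apply/lee_addgt0Pr => e e0.
(* Approximating with respect to [nu + mu] controls the error for both measures at once. *)
have finD : (measure_add nu mu D < +oo)%E.
  rewrite measure_addE; apply: lte_add_pinfty; last exact: fin0.
  exact: le_lt_trans (le_cell 0%N c) (fin0 c).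
have [m [S /=]] := cell_approximation mD finD mA e0.
set B := cell m @^-1` S; set E := _ `&` D => hE.
have {}hE : (nu E + mu E <= e%:E)%E by rewrite -measure_addE.
have mB : measurable B by exact: measurable_cell.
have mE : measurable E.
  by apply: measurableI => //; apply: measurableU; exact: measurableD.
have mBD : measurable (B `&` D) by exact: measurableI.
have mAD : measurable (A `&` D) by exact: measurableI.
have le_BD : (nu (B `&` D) <= mu (B `&` D))%E.
  apply: (@le_measure_fibres _ _ _ _ (@cell R n m)) => //.
    by move=> c'; exact: measurable_cell_eq.
  move=> c'; set K := _ @^-1` [set c'].
  have [-> //|[x [[Bx Dx] /= xc']]] : B `&` D `&` K = set0 \/ B `&` D `&` K !=set0.
    by have [->|/set0P] := eqVneq (B `&` D `&` K) set0; [left|right].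
    by rewrite !measure0.
  (* Both [B] and [D] are unions of cells of level [m], so a cell that meets their intersection lies
     inside it. *)
  suff -> : B `&` D `&` K = K by exact: le_cell.
  apply/seteqP; split => [y []//|y /= yc']; split => //; split.
    by rewrite /B /= yc' -xc'.
  by rewrite /D /= -Dx; apply: (cell_mono (leq0n m)); rewrite yc' xc'.
apply: (@le_trans _ _ (nu (B `&` D) + nu E)%E).
  rewrite (le_trans _ (measureU2 _ _ _))//; apply: le_measure; rewrite ?inE//.
    exact: measurableU.
  move=> x [Ax Dx]; have [Bx|nBx] := pselect (B x); first by left.
  by right; split => //; left.
apply: (@le_trans _ _ (mu (A `&` D) + (mu E + nu E))%E).
  rewrite addeA leeD// (le_trans le_BD)// (le_trans _ (measureU2 _ _ _))//.
  apply: le_measure; rewrite ?inE//; first exact: measurableU.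
  move=> x [Bx Dx]; have [Ax|nAx] := pselect (A x); first by left.
  by right; split => //; right.
by rewrite leeD// addeC.
Qed.

(** * Lipschitz maps and Lebesgue measure *)

Lemma lebesgue_cube (R : realType) (n : nat)
    (leb : set (n.-tuple R) -> \bar R) (x : n.-tuple R) (r : R) :
  is_lebesgue_Rn leb -> 0 <= r ->
  leb [set y | forall i, tnth x i <= tnth y i <= tnth x i + r] = (r ^+ n)%:E.
Proof.
move=> lebP r0; pose b := [tuple tnth x i + r | i < n].
rewrite (_ : mkset _ = [set y | forall i, tnth x i <= tnth y i <= tnth b i]).
  rewrite lebP => [|i]; last by rewrite tnth_mktuple lerDl.
  congr EFin; rewrite (eq_bigr (fun=> r)) ?prodr_const ?card_ord// => i _.
  by rewrite tnth_mktuple addrAC subrr add0r.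
by apply/seteqP; split => y /= H i; move: (H i); rewrite tnth_mktuple.
Qed.

(** Only closed boxes have a prescribed volume, so the half-open cell is bounded below by the closed
    cube of half its side at the same corner. *)
Lemma lebesgue_cell_ge (R : realType) (n : nat)
    (leb : {measure set (n.-tuple R) -> \bar R}) (m : nat) (c : n.-tuple int) :
  is_lebesgue_Rn leb ->
  ((((2 ^+ m)^-1 / 2) ^+ n)%:E <= leb (cell m @^-1` [set c]))%E.
Proof.
move=> lebP; pose a : n.-tuple R := [tuple (tnth c i)%:~R / 2 ^+ m | i < n].
have p0 : 0 < (2 ^+ m)^-1 :> R by rewrite invr_gt0 exprn_gt0.
rewrite -(lebesgue_cube a lebP); last by lra.
apply: le_measure; rewrite ?inE; last 2 first.
- exact: measurable_cell_eq.
- move=> y /= H; apply: eq_from_tnth => i; move: (H i); rewrite tnth_mktuple.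
  move=> /andP[h1 h2]; rewrite tnth_cell; apply: floor_def.
  rewrite mulrC -ler_pdivrMr ?exprn_gt0// h1/= -ltr_pdivlMr ?exprn_gt0//.
  by rewrite intrD1 mulrDl; lra.
rewrite (_ : mkset _ = [set y | forall i, tnth a i <= tnth y i <=
    tnth [tuple tnth a i + (2 ^+ m)^-1 / 2 | i < n] i]); first exact: measurable_box.
by apply/seteqP; split => y /= H i; move: (H i); rewrite tnth_mktuple.
Qed.

Lemma lebesgue_cell_lty (R : realType) (n : nat)
    (leb : {measure set (n.-tuple R) -> \bar R}) (m : nat) (c : n.-tuple int) :
  is_lebesgue_Rn leb -> (leb (cell m @^-1` [set c]) < +oo)%E.
Proof.
move=> lebP.
pose a : n.-tuple R := [tuple (tnth c i)%:~R / 2 ^+ m | i < n].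
pose b : n.-tuple R := [tuple ((tnth c i)%:~R + 1) / 2 ^+ m | i < n].
have ab i : tnth a i <= tnth b i.
  by rewrite !tnth_mktuple ler_wpM2r ?invr_ge0 ?exprn_ge0// lerDl.
apply: le_lt_trans (ltry (\prod_(i < n) (tnth b i - tnth a i))).
rewrite -lebP//; apply: le_measure; rewrite ?inE.
- exact: measurable_cell_eq.
- exact: measurable_box.
- by move=> y /= yc i; rewrite !tnth_mktuple -yc cell_ge ltW// cell_lt.
Qed.

(** The Lipschitz condition for the sup norm, with a bound [r] in place of the norm so that it
    applies to tuples. *)
Definition coord_lipschitz (R : realType) (n : nat) (L : R)
    (X : set (n.-tuple R)) (f : n.-tuple R -> n.-tuple R) :=
  forall x y, X x -> X y -> forall r, 0 <= r ->
    (forall i, `|tnth x i - tnth y i| <= r) ->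
    forall i, `|tnth (f x) i - tnth (f y) i| <= L * r.

Lemma lipschitz_coord (R : realType) (n : nat) (X : set (n.-tuple R))
    (f : n.-tuple R -> n.-tuple R) :
  [lipschitz rv_map f v | v in [set rv_of x | x in X]] ->
  exists2 L, 0 < L & coord_lipschitz L X f.
Proof.
(* The Lipschitz bound holds for every constant above [M]; this one is also positive. *)
move=> [M [_ HM]]; exists (Num.max M 0 + 1); first by rewrite ltr_wpDl// le_max lexx orbT.
move=> x y Xx Xy r r0 xyr i.
have rvK (z : n.-tuple R) : tup_of (rv_of z) = z.
  by apply: eq_from_tnth => j; rewrite tnth_mktuple mxE.
have := HM (Num.max M 0 + 1); rewrite ltr_pwDr ?le_max ?lexx// => /(_ isT).
move=> lip; have /= := lip (rv_of x, rv_of y) (conj (imageP _ Xx) (imageP _ Xy)).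
rewrite /rv_map !rvK => H.
apply: (@le_trans _ _ `|rv_of (f x) - rv_of (f y)|).
  rewrite [leRHS]/Num.norm/= mx_normrE.
  apply: le_trans (le_bigmax _ _ (ord0, i)) => /=.
  by rewrite !mxE.
apply: le_trans H _; rewrite ler_wpM2l//.
  by rewrite ltW// ltr_wpDl// le_max lexx orbT.
rewrite [leLHS]/Num.norm/= mx_normrE; apply: bigmax_le => // -[j k] _ /=.
by rewrite !mxE.
Qed.

Lemma coord_lipschitz_close (R : realType) (n : nat) (L : R)
    (X : set (n.-tuple R)) (f : n.-tuple R -> n.-tuple R) :
  0 < L -> coord_lipschitz L X f ->
  forall x, X x -> forall e, 0 < e -> exists2 d, 0 < d &
     forall y, X y -> close d x y -> close e (f x) (f y).
Proof.
move=> L0 fL x Xx e e0; exists (e / (2 * L)); first by rewrite divr_gt0// mulr_gt0.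
move=> y Xy xy i.
have e2 : L * (e / (2 * L)) < e.
  rewrite invfM (mulrC 2^-1) !mulrA (mulrC L) mulfK ?lt0r_neq0//; lra.
apply: le_lt_trans e2; apply: fL => //; last by move=> j; exact: ltW.
by rewrite ltW// divr_gt0// mulr_gt0.
Qed.

(** Both sides are measures in [A], the left one a pushforward under [g], so cells suffice. One
    factor 2 of the constant turns a radius into a side; the other pays for the half-side cube in
    [lebesgue_cell_ge]. *)
Lemma lipschitz_measure_le (R : realType) (n : nat)
    (leb : {measure set (n.-tuple R) -> \bar R}) (L : R) (X Z : set (n.-tuple R))
    (f g : n.-tuple R -> n.-tuple R) :
  is_lebesgue_Rn leb -> 0 < L -> coord_lipschitz L X f ->
  measurable Z -> measurable_fun setT g ->
  (forall z, Z z -> X (g z) /\ f (g z) = z) ->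
  forall A, measurable A ->
    (leb (g @^-1` A `&` Z) <= ((4 * L) ^+ n)%:E * leb A)%E.
Proof.
move=> lebP L0 fL mZ mg gZ.
have C0 : 0 <= (4 * L) ^+ n by rewrite exprn_ge0// mulr_ge0// ltW.
pose mu : {measure set _ -> \bar R} := mscale (NngNum C0) leb.
(* Given explicitly: this instance depends on [mg] and is not inferred. *)
pose nu : {measure set (n.-tuple R) -> \bar R} :=
  measure_function_pushforward__canonical__measure_function_Measure (mrestr leb mZ) mg.
suff H : forall A, measurable A -> (nu A <= mu A)%E by exact: H.
apply: le_measure_cells => [c|m c].
  by apply: lte_mul_pinfty => //; exact: lebesgue_cell_lty.
have mcell := @measurable_cell_eq R n m c.
rewrite /nu /mu /= /pushforward /mrestr /mscale /=.
have p0 : 0 < (2 ^+ m)^-1 :> R by rewrite invr_gt0 exprn_gt0.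
apply: (@le_trans _ _ (((4 * L) ^+ n)%:E * (((2 ^+ m)^-1 / 2) ^+ n)%:E)%E); last first.
  by rewrite lee_pmul2l// ?lte_fin ?exprn_gt0 ?mulr_gt0//; exact: lebesgue_cell_ge.
rewrite -EFinM -exprMn.
have [-> //|[z0 [/= gz0 Zz0]]] : g @^-1` (cell m @^-1` [set c]) `&` Z = set0 \/
    g @^-1` (cell m @^-1` [set c]) `&` Z !=set0.
- by have [->|/set0P] := eqVneq (g @^-1` (cell m @^-1` [set c]) `&` Z) set0; [left|right].
- by rewrite measure0 lee_fin exprn_ge0//; nra.
(* Points of [Z] sent by [g] into the cell of [g z0] stay within [r] of [z0], hence in a closed cube
   of side [2 * r] with corner [a]. *)
pose r := L * (2 ^+ m)^-1.
pose a : n.-tuple R := [tuple tnth z0 i - r | i < n].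
rewrite (_ : 4 * L * _ = 2 * r); last by rewrite /r; lra.
have r0 : 0 < r by rewrite mulr_gt0.
rewrite -(lebesgue_cube a lebP); last by lra.
apply: le_measure; rewrite ?inE.
- by apply: measurableI => //; have := mg measurableT _ mcell; rewrite setTI.
- rewrite (_ : mkset _ = [set y | forall i, tnth a i <= tnth y i <=
    tnth [tuple tnth a i + 2 * r | i < n] i]); first exact: measurable_box.
  by apply/seteqP; split => y /= H i; move: (H i); rewrite tnth_mktuple.
move=> z [/= gz Zz] i; rewrite tnth_mktuple.
have [Xgz fgz] := gZ z Zz; have [Xgz0 fgz0] := gZ z0 Zz0.
have : `|tnth z i - tnth z0 i| <= r.
  rewrite -{1}fgz -{1}fgz0; apply: fL => // j.
  have := cell_ge m (g z) j; have := cell_lt m (g z) j.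
  have := cell_ge m (g z0) j; have := cell_lt m (g z0) j.
  by rewrite gz gz0 !mulrDl mul1r ler_norml => *; apply/andP; split; lra.
by rewrite ler_norml => /andP[? ?]; apply/andP; split; lra.
Qed.

(** * Integrals, risks and L^p *)

Section nonneg_simple_functions.
Import HBNNSimple.

(** A nonnegative simple function below the restriction of [f] to [D] vanishes off [D], so its
    nonzero level sets have the same measure under [mu] and [mrestr mu mD]. *)
Lemma le_integral_mrestr d (T : measurableType d) (R : realType)
    (mu : {measure set T -> \bar R}) (D : set T) (mD : measurable D) (f : T -> \bar R) :
  (forall x, (0 <= f x)%E) ->
  (\int[mu]_(x in D) f x <= \int[mrestr mu mD]_x f x)%E.
Proof.
move=> f0; rewrite !ge0_integralE//; apply: ge_ereal_sup => _ [h hf <-].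
apply: le_ereal_sup_tmp; exists (sintegral (mrestr mu mD) h).
  exists h => // x; rewrite patch_setT; apply: le_trans (hf x) _.
  by rewrite patchE; case: ifP.
rewrite !sintegralE; apply: lee_fsum => // r _.
have [->|r0] := eqVneq r 0; first by rewrite !mul0e.
rewrite le_eqVlt; apply/orP; left; apply/eqP; congr (_ * mu _)%E.
apply/seteqP; split => [x /= hr|x []//]; split => //.
have := hf x; rewrite patchE; case: ifPn => [/[!inE]//|_].
rewrite hr lee_fin => rle0; exfalso; move/negP: r0; apply.
by rewrite eq_le rle0 -hr /= fun_ge0.
Qed.

(* [f] and [g] need not be measurable: only the nonnegative simple functions
   below them are modified off [A]. *)
Lemma eq_integral_full d (T : measurableType d) (R : realType)
    (mu : {measure set T -> \bar R}) (A : set T) (f g : T -> \bar R) :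
  measurable A -> mu (~` A) = 0%E -> (forall x, A x -> f x = g x) ->
  (\int[mu]_x f x = \int[mu]_x g x)%E.
Proof.
move=> mA muA0.
have half (F G : T -> \bar R) : (forall x, (0 <= F x)%E) -> (forall x, (0 <= G x)%E) ->
    (forall x, A x -> F x = G x) -> (\int[mu]_x F x <= \int[mu]_x G x)%E.
  move=> F0 G0 FG; rewrite !ge0_integralE//; apply: ge_ereal_sup => _ [h hF <-].
  pose h' := proj_nnsfun h mA.
  have h'E x : h' x = h x * (x \in A)%:R by rewrite /h' /proj_nnsfun /= mindicE.
  apply: le_ereal_sup_tmp; exists (sintegral mu h').
    exists h' => // x; rewrite patch_setT h'E.
    have [xA|xA] := boolP (x \in A); last by rewrite mulr0.
    by rewrite mulr1; have := hF x; rewrite patch_setT FG// -in_setE.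
  rewrite -!integralT_nnsfun le_eqVlt; apply/orP; left; apply/eqP.
  apply: ge0_ae_eq_integral => //.
  - exact/measurable_EFinP.
  - exact/measurable_EFinP.
  - by move=> x _; rewrite lee_fin.
  - by move=> x _; rewrite lee_fin.
  - exists (~` A); split => //; first exact: measurableC.
    move=> x /=; apply: contra_not => Ax _.
    have := h'E x; rewrite mem_set// mulr1 => h'x.
    exact: (congr1 EFin (esym h'x)).
move=> fg.
have eq0 (F G : T -> \bar R) : (forall x, (0 <= F x)%E) -> (forall x, (0 <= G x)%E) ->
    (forall x, A x -> F x = G x) -> (\int[mu]_x F x = \int[mu]_x G x)%E.
  move=> F0 G0 FG; apply/eqP; rewrite eq_le !half// => x /FG ->//.
rewrite (integralE _ _ f) (integralE _ _ g); congr (_ - _)%E; apply: eq0 => // x Ax.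
  by rewrite !funeposE fg.
by rewrite !funenegE fg.
Qed.

End nonneg_simple_functions.

Lemma eq_risk (R : realType) (n : nat) (E : finType)
    (P : E -> probability (n.-tuple R * R)%type R) (loss : R -> R -> R)
    (X : set (n.-tuple R)) (e : E) (f g : n.-tuple R -> R) :
  measurable X -> P e (X `*` setT) = 1%E -> (forall x, X x -> f x = g x) ->
  risk P loss e f = risk P loss e g.
Proof.
move=> mX PX fg; apply: (@eq_integral_full _ _ _ _ (X `*` setT)).
- exact: measurableX.
- transitivity (1 - P e (X `*` setT))%E; last by rewrite PX subee.
  exact: (probability_setC (P e) (measurableX mX measurableT)).
- by move=> [x y] [/= Xx _]; rewrite fg.
Qed.

Section Lp_space.
Context (R : realType) (n : nat) (leb : {measure set (n.-tuple R) -> \bar R}).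
Context (p : R) (X : set (n.-tuple R)) (p1 : 1 <= p) (mX : measurable X).
Implicit Types f g : n.-tuple R -> R.

Lemma measurable_norm_powR f :
  measurable_fun X f -> measurable_fun X (fun x => ((`|f x| `^ p)%:E)).
Proof.
move=> mf; apply/measurable_EFinP.
apply: (@measurableT_comp _ _ _ _ _ _ (fun y : R => y `^ p)) => //.
exact: measurableT_comp.
Qed.

(** If [|a| <= |b|], then [|a + b| ^ p <= (2 |b|) ^ p <= 2 ^ p (|a| ^ p + |b| ^ p)]. *)
Lemma Lp_add f g : Lp leb p X f -> Lp leb p X g -> Lp leb p X (fun x => f x + g x).
Proof.
move=> [mf intf] [mg intg]; split; first exact: measurable_funD.
have p0 : 0 <= p by apply: le_trans p1.
apply: (@le_lt_trans _ _ (\int[leb]_(x in X)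
    ((2 `^ p)%:E * ((`|f x| `^ p)%:E + (`|g x| `^ p)%:E)))%E).
  apply: ge0_le_integral => //.
  - by apply: measurable_norm_powR; exact: measurable_funD.
  - apply: measurable_funeM; apply: emeasurable_funD; exact: measurable_norm_powR.
  move=> x _; rewrite -EFinD -EFinM lee_fin.
  move: (f x) (g x) => a b.
  wlog ab : a b / `|a| <= `|b|.
    move=> H; have [ab|/ltW ba] := leP `|a| `|b|; first exact: H.
    by rewrite addrC (addrC (_ `^ _)); exact: H.
  apply: (@le_trans _ _ ((2 * `|b|) `^ p)).
    apply: ge0_ler_powR; rewrite ?nnegrE ?mulr_ge0//.
    by rewrite (le_trans (ler_normD _ _))//; lra.
  by rewrite powRM// ler_wpM2l ?powR_ge0// lerDr powR_ge0.
rewrite ge0_integralZl_EFin ?powR_ge0//; last 2 first.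
- by move=> x _; rewrite -EFinD lee_fin addr_ge0 ?powR_ge0.
- by apply: emeasurable_funD; exact: measurable_norm_powR.
rewrite ge0_integralD//; try exact: measurable_norm_powR;
  try by move=> x _; rewrite lee_fin powR_ge0.
by apply: lte_mul_pinfty; rewrite ?lee_fin ?powR_ge0//; exact: lte_add_pinfty.
Qed.

Lemma Lp_scale c f : Lp leb p X f -> Lp leb p X (fun x => c * f x).
Proof.
move=> [mf intf]; split; first exact: measurable_funM.
rewrite (eq_integral (fun x => (`|c| `^ p)%:E * (`|f x| `^ p)%:E)%E); last first.
  by move=> x _; rewrite normrM powRM.
rewrite ge0_integralZl_EFin ?powR_ge0//; last exact: measurable_norm_powR.
by apply: lte_mul_pinfty; rewrite ?lee_fin ?powR_ge0.
Qed.

Lemma Lp_sum (I : finType) (Q : pred I) (F : I -> n.-tuple R -> R) :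
  (forall i, Lp leb p X (F i)) -> Lp leb p X (fun x => \sum_(i | Q i) F i x).
Proof.
move=> LF; rewrite -fct_sumE; elim/big_rec: _ => [|i f _ Lf].
  split; first exact: measurable_cst.
  rewrite integral0_eq// => x _.
  by rewrite normr0 powR0// gt_eqF// (lt_le_trans ltr01 p1).
exact: Lp_add.
Qed.

End Lp_space.

(** The integral over [Z] becomes one against the pushforward of Lebesgue measure under [g], which
    [lipschitz_measure_le] dominates by a multiple of Lebesgue measure. *)
Lemma Lp_comp_inverse (R : realType) (n : nat)
    (leb : {measure set (n.-tuple R) -> \bar R}) (p L : R) (X Z : set (n.-tuple R))
    (f g : n.-tuple R -> n.-tuple R) (w : n.-tuple R -> R) :
  is_lebesgue_Rn leb -> 0 < L -> coord_lipschitz L X f ->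
  measurable X -> measurable Z -> measurable_fun setT g ->
  (forall z, Z z -> X (g z) /\ f (g z) = z) ->
  Lp leb p X w -> Lp leb p Z (w \o g).
Proof.
move=> lebP L0 fL mX mZ mg gZ [mw intw]; split.
  apply: (measurable_comp mX _ mw); last exact: measurable_funTS.
  by move=> _ [z /gZ[Xgz _] <-].
pose F := (fun x => (`|w x| `^ p)%:E) \_ X.
have F0 x : (0 <= F x)%E by rewrite /F patchE; case: ifP => // _; rewrite lee_fin powR_ge0.
have mF : measurable_fun setT F.
  by apply/(measurable_restrictT _ mX); exact: measurable_norm_powR.
rewrite (eq_integral (F \o g)); last first.
  by move=> z /[!inE] /gZ[Xgz _]; rewrite /F /= patchE mem_set.
apply: (@le_lt_trans _ _ (\int[mrestr leb mZ]_x (F \o g) x)%E).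
  by apply: le_integral_mrestr => z; exact: F0.
have := @ge0_integral_pushforward _ _ _ _ R g mg (mrestr leb mZ) setT F measurableT mF.
rewrite preimage_setT => <-; last by move=> y _; exact: F0.
have C0 : 0 <= (4 * L) ^+ n by rewrite exprn_ge0// mulr_ge0// ltW.
pose nu : {measure set (n.-tuple R) -> \bar R} :=
  measure_function_pushforward__canonical__measure_function_Measure (mrestr leb mZ) mg.
apply: (@le_lt_trans _ _ (\int[mscale (NngNum C0) leb]_x F x)%E).
  apply: (@ge0_le_measure_integral _ _ _ nu) => // A mA.
  exact: (lipschitz_measure_le lebP L0 fL mZ mg gZ mA).
rewrite ge0_integral_mscale//; apply: lte_mul_pinfty; rewrite ?lee_fin//.
by rewrite -integral_mkcond.
Qed.

(** * Invariant predictors and Nash equilibria *)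

Lemma eq_Lp (R : realType) (n : nat) (leb : {measure set (n.-tuple R) -> \bar R})
    (p : R) (X : set (n.-tuple R)) (f g : n.-tuple R -> R) :
  (forall x, X x -> f x = g x) -> Lp leb p X f -> Lp leb p X g.
Proof.
move=> fg [mf intf]; split.
  by apply: eq_measurable_fun mf => x /[!inE]; exact: fg.
by rewrite (eq_integral (fun x => (`|f x| `^ p)%:E))// => x /[!inE] /fg ->.
Qed.

(** Extended by the identity off [Z], the inverse pulls [A] back to the image of [A] within [X]
    together with the part of [A] outside [Z]. *)
Lemma measurable_inverse (R : realType) (n : nat) (L : R) (X Z : set (n.-tuple R))
    (f h : n.-tuple R -> n.-tuple R) :
  0 < L -> coord_lipschitz L X f -> measurable X -> measurable Z ->
  (forall x, X x -> Z (f x)) -> (forall z, Z z -> X (h z)) ->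
  (forall x, X x -> h (f x) = x) -> (forall z, Z z -> f (h z) = z) ->
  measurable_fun setT (fun z => if z \in Z then h z else z).
Proof.
move=> L0 fL mX mZ XZ ZX hf fh _ A mA; rewrite setTI.
rewrite (_ : _ @^-1` A = (f @` (A `&` X)) `|` (A `\` Z)).
  apply: measurableU; last exact: measurableD.
  apply: (@measurable_image_inj _ _ f X Z) => //.
  - exact: coord_lipschitz_close fL.
  - by move=> x y Xx Xy fxy; rewrite -(hf x)// fxy hf.
  - apply/seteqP; split => [_ [x Xx <-]|z Zz]; first exact: XZ.
    by exists (h z); [exact: ZX|exact: fh].
  - exact: measurableI.
apply/seteqP; split => z /=.
  case: ifPn => [/[!inE] Zz Ahz|zZ Az]; last by right; split => // Zz; rewrite mem_set in zZ.
  by left; exists (h z); [split => //; exact: ZX|exact: fh].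
move=> [[x [Ax Xx] <-]|[Az nZ]]; first by rewrite mem_set ?hf//; exact: XZ.
by rewrite memNset.
Qed.

Lemma invariant_eq_nash (R : realType) (n : nat) (E : finType)
    (P : E -> probability (n.-tuple R * R)%type R) (loss : R -> R -> R)
    (leb : {measure set (n.-tuple R) -> \bar R}) (p : R) (X : set (n.-tuple R)) :
  (0 < #|E|)%N -> 1 <= p -> measurable X ->
  ShatIV_X_id P loss leb p X = ShatEIRM_X_id P loss leb p X.
Proof.
move=> E0 p1 mX; have E0R : #|E|%:R != 0 :> R by rewrite pnatr_eq0 -lt0n.
have Lwavg ws : (forall e, Lp leb p X (ws e)) -> Lp leb p X (wavg ws).
  by move=> Lws; apply: Lp_scale => //; apply: Lp_sum.
apply/seteqP; split => u.
  move=> [w [Lw [inv uw]]].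
  (* An invariant [w] is an equilibrium when every environment plays it: a deviation only produces
     another average in [L^p(X)]. *)
  have wE : wavg (fun _ : E => w) = w.
    apply/funext => x; rewrite /wavg sumr_const -[X in _ * X]mulr_natl mulrA.
    by rewrite mulVf// mul1r.
  exists (fun=> w); split; last by rewrite wE.
  split => // e v Lv; rewrite wE; apply/negP; rewrite -leNgt leeN2.
  apply: (inv (wavg (deviate (fun=> w) e v)) _ e).
  by apply: Lwavg => q; rewrite /deviate; case: ifP.
move=> [ws [[Lws nash] uw]]; exists (wavg ws); split; first exact: Lwavg.
split => // wbar Lwbar e.
(* The deviation of player [e] that turns the average into [wbar]. *)
pose v x := #|E|%:R * wbar x + -1 * \sum_(q | q != e) ws q x.
have Lv : Lp leb p X v.
  by apply: Lp_add => //; apply: Lp_scale => //; exact: Lp_sum.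
have vE : wavg (deviate ws e v) = wbar.
  apply/funext => x; rewrite /wavg (bigD1 e)//= {1}/deviate eqxx /v.
  rewrite (eq_bigr (fun q => ws q x)); last first.
    by move=> q /negPf qe; rewrite /deviate qe.
  by rewrite mulN1r subrK mulrA mulVf// mul1r.
by have /negP := nash e v Lv; rewrite vE -leNgt leeN2.
Qed.

Theorem theorem2 (R : realType) (n : nat) (E : finType)
  (P : E -> probability (n.-tuple R * R)%type R) (loss : R -> R -> R)
  (leb : {measure set (n.-tuple R) -> \bar R}) (p : R)
  (X Z : set (n.-tuple R)) (HPhi : set (n.-tuple R -> n.-tuple R)) :
  is_lebesgue_Rn leb ->
  (0 < #|E|)%N ->
  1 <= p ->
  measurable X -> measurable Z ->
  (forall e : E, P e (X `*` setT) = 1%E) ->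
  (forall Phi, HPhi Phi ->
     (forall x, X x -> Z (Phi x)) /\
     (exists Psi : n.-tuple R -> n.-tuple R,
        (forall z, Z z -> X (Psi z)) /\
        (forall x, X x -> Psi (Phi x) = x) /\
        (forall z, Z z -> Phi (Psi z) = z)) /\
     (forall x, X x -> differentiable (rv_map Phi) (rv_of x)) /\
     [lipschitz rv_map Phi v | v in [set rv_of x | x in X]]) ->
  SbarIV_Z P loss leb p X Z HPhi !=set0 ->
  SbarIV_Z P loss leb p X Z HPhi = ShatIV_X_id P loss leb p X /\
  ShatIV_X_id P loss leb p X = ShatEIRM_X_id P loss leb p X.
Proof.
move=> lebP E0 p1 mX mZ PX hPhi [u0 [Phi0 [w0 [HPhi0 [Lw0 [inv0 [u0E Lu0]]]]]]].
have pull Phi : HPhi Phi -> exists2 g, (forall x, X x -> g (Phi x) = x) &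
    forall w, Lp leb p X w -> Lp leb p Z (w \o g).
  move=> /hPhi[XZ [[Psi [ZX [PsiK PhiK]]] [_ /lipschitz_coord[L L0 PhiL]]]].
  exists (fun z => if z \in Z then Psi z else z).
    by move=> x Xx; rewrite mem_set ?PsiK//; exact: XZ.
  move=> w; apply: (Lp_comp_inverse lebP L0 PhiL mX mZ).
    exact: (measurable_inverse L0 PhiL).
  by move=> z Zz; rewrite mem_set// PhiK//; split => //; exact: ZX.
have riskX e f g : (forall x, X x -> f x = g x) -> risk P loss e f = risk P loss e g.
  exact: eq_risk.
split; last exact: invariant_eq_nash.
apply/seteqP; split => u.
  move=> [Phi [w [/pull[g gK Lg] [Lw [inv [uE Lu]]]]]].
  (* The competitor [wbar] is moved to [wbar \o g] on [Z]; after composition with [Phi] it agrees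
     with [wbar] on [X]. *)
  exists u; split => //; split => // wbar Lwbar e.
  rewrite (riskX e _ _ uE); apply: le_trans (inv _ (Lg _ Lwbar) e) _.
  by rewrite le_eqVlt; apply/orP; left; apply/eqP/riskX => x Xx /=; rewrite gK.
move=> [v [Lv [inv uv]]]; have [g gK Lg] := pull _ HPhi0.
exists Phi0, (v \o g); split => //; split; first exact: Lg.
split; last split.
(* The risk of [v] is at most that of [u0], as [u0] is in [L^p(X)], and the risk of [u0] is at most
   that of [wbar \o Phi0]. *)
- move=> wbar Lwbar e; apply: le_trans (inv0 _ Lwbar e).
  rewrite -(riskX e _ _ u0E); apply: le_trans (inv _ Lu0 e).
  by rewrite le_eqVlt; apply/orP; left; apply/eqP/riskX => x Xx /=; rewrite gK.
- by move=> x Xx /=; rewrite gK// uv.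
- by apply: eq_Lp Lv => x /uv ->.
Qed.
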